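(* Let $f:\mathbb{R}^n\times\mathbb{R}^d\to\mathbb{R}^n$ be continuous and consider the family of differential equations $\frac{dx}{dt}=f(x,\eta)$, $x\in\mathbb{R}^n$, indexed by the parameter $\eta\in\mathbb{R}^d$. Suppose that for every $\eta\in\mathbb{R}^d$ the manifold $M=\{x\in\mathbb{R}^n: F(x)=0\}$ is invariant under the flow of $\frac{dx}{dt}=f(x,\eta)$. Then, for any $\mathbb{R}^d$-valued stochastic process $\eta_t$ with continuous sample paths, the $\eta_t$-RODE version of the family, $\frac{dx}{dt}=f(x,\eta_t(\omega))$, preserves the invariance of $M$; that is, for almost every $\omega$, every solution $x_t$ with $x_0\in M$ satisfies $x_t\in M$ for all $t\ge 0$ for which it is defined.
   Context: $F:\mathbb{R}^n\to\mathbb{R}$ is of class $C^2$ and $M=\{F=0\}$ is a codimension-one submanifold of $\mathbb{R}^n$ whose normal vector at $x\in M$ is $\nabla F(x)$. $M$ is invariant under the flow of an ODE $\dot x=g(t,x)$ if for all $x_0\in M$ the maximal solution starting at $x_0$ at $t=0$ stays in $M$ for all $t\ge 0$; the invariance condition is written $\nabla F(x)\cdot g(t,x)=0$ for all $(t,x)\in\mathbb{R}^+\times M$. Let $(\Omega,\mathcal F,P)$ be a probability space and $\eta_t(\omega)$ an $\mathbb{R}^d$-valued stochastic process with continuous sample paths. The $\eta_t$-RODE (random ordinary differential equation) version of the family $\frac{dx}{dt}=f(x,\eta)$ is the family of equations $\frac{dx}{dt}=f(x,\eta_t(\omega))$ for almost every realization $\omega\in\Omega$, interpreted pathwise. Solutions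 are assumed to exist and be unique pathwise (e.g. $f$ globally Lipschitz in $x$). *)

(* Defs.v *)
From HB Require Import structures.
From mathcomp Require Import all_boot all_order all_algebra.
From mathcomp Require Import all_classical all_reals all_analysis.

Set Implicit Arguments.
Unset Strict Implicit.
Unset Printing Implicit Defensive.

Import Order.TTheory GRing.Theory Num.Theory.
Import numFieldNormedType.Exports.

Local Open Scope classical_set_scope.
Local Open Scope ring_scope.

Section hypersurface.
Context {R : realType} {n : nat}.
Implicit Type F : 'rV[R]_n -> R.

Definition partial (i : 'I_n) F : 'rV[R]_n -> R := 'D_(delta_mx ord0 i) F.

Definition gradient F (x : 'rV[R]_n) : 'rV[R]_n := \row_i partial i F x.

Definition class_C1 F : Prop :=
  forall i, (forall x, derivable F x (delta_mx ord0 i)) /\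
            continuous (partial i F).

Definition class_C2 F : Prop :=
  class_C1 F /\ forall i, class_C1 (partial i F).

Definition zero_set F : set 'rV[R]_n := [set x | F x = 0].

(* For F of class C^2 this makes {F = 0} a codimension-one submanifold whose
   normal line at x is spanned by the gradient of F at x. *)
Definition normal_gradient F : Prop :=
  forall x, zero_set F x -> gradient F x != 0.

End hypersurface.

(* Forward initial value problems x' = g(t, x) with initial time 0. *)
Section ode.
Context {R : realType} {n : nat}.
Implicit Types (g : R -> 'rV[R]_n -> 'rV[R]_n) (J : set R) (x : R -> 'rV[R]_n).

Definition time_domain J : Prop :=
  [/\ is_interval J, J `<=` [set t | 0 <= t], J 0 & exists2 t, J t & 0 < t].

(* The derivative is taken within J, hence one-sided at the endpoints of J.
   The values of x outside J are irrelevant. *)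
Definition is_solution g J x : Prop :=
  time_domain J /\
  forall t, J t ->
    (s - t)^-1 *: (x s - x t) @[s --> within J t^'] --> g t (x t).

Definition is_maximal_solution g J x : Prop :=
  is_solution g J x /\
  forall K y, is_solution g K y -> J `<=` K ->
    (forall t, J t -> y t = x t) -> K `<=` J.

Definition solutions_exist g : Prop :=
  forall x0 : 'rV[R]_n, exists J x, is_solution g J x /\ x 0 = x0.

Definition solutions_unique g : Prop :=
  forall J x K y, is_solution g J x -> is_solution g K y -> x 0 = y 0 ->
    forall t, J t -> K t -> x t = y t.

Definition well_posed g : Prop := solutions_exist g /\ solutions_unique g.

Definition flow_invariant g (M : set 'rV[R]_n) : Prop :=
  forall J x, is_maximal_solution g J x -> M (x 0) ->
    forall t, J t -> M (x t).

End ode.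

(* Only the times t >= 0 matter. The Borel sets of R^d form the product
   sigma-algebra, so measurability is stated coordinatewise. *)
Definition continuous_process {R : realType} {dO : measure_display}
    {Omega : measurableType dO} {d : nat} (eta : R -> Omega -> 'rV[R]_d) : Prop :=
  (forall t, 0 <= t -> forall i, measurable_fun setT (fun w => eta t w ord0 i)) /\
  (forall w, {within [set t | 0 <= t], continuous (fun t => eta t w)}).

Definition rode {R : realType} {n d : nat} {Omega : Type}
    (f : 'rV[R]_n * 'rV[R]_d -> 'rV[R]_n) (eta : R -> Omega -> 'rV[R]_d)
    (w : Omega) : R -> 'rV[R]_n -> 'rV[R]_n :=
  fun t x => f (x, eta t w).

(* Main.v *)
Require Import Defs.
From HB Require Import structures.
From mathcomp Require Import all_boot all_order all_algebra.
From mathcomp Require Import all_classical all_reals all_analysis.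
From mathcomp Require Import ring lra.
Import Order.TTheory GRing.Theory Num.Theory.
Import numFieldNormedType.Exports.
Local Open Scope classical_set_scope.
Local Open Scope ring_scope.

(** Invariance of [M = {F = 0}] under each frozen equation [x' = f (x, e)] forces
    a pointwise condition on [f]: differentiating [F] along a solution that stays
    in [M] gives [grad F (x) . f (x, e) = 0] for [x] in [M]
    ([flow_invariant_tangent]). It holds for every [e], hence for
    [e = eta_t (w)] at every time, so the non-autonomous field
    [G (t, x) = f (x, eta_t (w))] of a realization is tangent to [M] as well.

    Tangency on [M] only does not by itself keep a given solution in [M], since
    [G] is merely continuous; uniqueness of solutions has to enter. It enters
    through the construction of one solution that does stay in [M]. Near a point
    of [M] the gradient does not vanish, and subtracting from [G] its component
    along [grad F] gives a continuous field that is tangent to all level sets of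
    [F] and agrees with [G] on [M]. By Peano's theorem ([peano]) it has a local
    solution; [F] is constant along it, so it lies in [M] and therefore solves
    the original equation ([level_set_viable]).

    Now let [x] be a solution that starts in [M] and is outside [M] at time
    [t1], and let [a] be the supremum of the times up to [t1] at which [x] is
    in [M]. Following [x] up to [a] and a solution in [M] from there on yields
    a second solution with the same initial value. It coincides with [x] by
    uniqueness, which puts [x] in [M] at times later than [a], a contradiction
    ([tangent_field_invariant]). Gluing at [a] instead of restarting at [a]
    matters, because uniqueness is available for initial time 0 only.

    Peano's theorem is proved with step functions from Euler's scheme and a
    limit along a free ultrafilter, along which they converge at every time.
    Pointwise convergence suffices: the approximations are Lipschitz up to the
    step size, so the field is nearly constant along them over a short time
    interval, and the resulting estimate on increments passes to the limit and
    is the derivative of the limit. *)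

(** * Derivatives relative to a set of times *)

(** The form of [x' (t) = v], relative to the times in [J], without a quotient:
    it makes sense at [s = t], and it can be glued and passed to the limit. *)
Definition slope_in {R : realType} {V : normedModType R} (J : set R)
    (x : R -> V) (t : R) (v : V) : Prop :=
  forall e, 0 < e ->
    \forall s \near t, J s -> `|x s - x t - (s - t) *: v| <= e * `|s - t|.

Lemma slope_inP {R : realType} {V : normedModType R} (J : set R)
    (x : R -> V) (t : R) (v : V) :
  ((s - t)^-1 *: (x s - x t) @[s --> within J t^'] --> v) <-> slope_in J x t v.
Proof.
have quot (s e : R) : s != t ->
    (`|v - (s - t)^-1 *: (x s - x t)| <= e)
    = (`|x s - x t - (s - t) *: v| <= e * `|s - t|).
  move=> st; have st0 : s - t != 0 by rewrite subr_eq0.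
  rewrite -[x s - x t in RHS](scalerKV st0) -scalerBr normrZ mulrC.
  by rewrite ler_pM2r ?normr_gt0 // distrC.
split=> [/cvgrPdist_le h e e0|h].
  have := h e e0; rewrite !near_withinE; apply: filterS => s hs Js.
  have [->|st] := eqVneq s t; last by rewrite -quot //; exact: hs.
  by rewrite !subrr scale0r subr0 !normr0 mulr0.
apply/cvgrPdist_le => e e0; rewrite !near_withinE.
by apply: filterS (h e e0) => s hs st Js; rewrite quot //; exact: hs.
Qed.

Lemma slope_in_near {R : realType} {V : normedModType R} (J K : set R)
    (x y : R -> V) (t : R) (v : V) :
  (\forall s \near t, K s -> J s /\ y s = x s) -> y t = x t ->
  slope_in J x t v -> slope_in K y t v.
Proof.
move=> KJ yx xv e e0; have := xv e e0.
apply: filterS2 KJ => s Ks Js /Ks [sJ ->].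
by rewrite yx; exact: Js.
Qed.

Lemma slope_inU {R : realType} {V : normedModType R} (J K : set R)
    (x : R -> V) (t : R) (v : V) :
  slope_in J x t v -> slope_in K x t v -> slope_in (J `|` K) x t v.
Proof.
move=> xJ xK e e0; apply: filterS2 (xJ e e0) (xK e e0) => s sJ sK.
by case=> [/sJ|/sK].
Qed.

Lemma slope_in_shift {R : realType} {V : normedModType R} (J : set R)
    (x : R -> V) (a t : R) (v : V) :
  slope_in J x (t - a) v ->
  slope_in [set s | J (s - a)] (fun s => x (s - a)) t v.
Proof.
move=> xv e e0.
have sub_cvg : s - a @[s --> t] --> t - a.
  by apply: cvgB; [exact: cvg_id|exact: cvg_cst].
have : \forall s \near t, J (s - a) ->
    `|x (s - a) - x (t - a) - (s - a - (t - a)) *: v|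
      <= e * `|s - a - (t - a)| by exact: sub_cvg (xv e e0).
by apply: filterS => s /= h /h; rewrite opprB addrA subrK.
Qed.

Lemma slope_in_lipschitz {R : realType} {V : normedModType R} (J : set R)
    (x : R -> V) (t : R) (v : V) : slope_in J x t v ->
  \forall s \near t, J s -> `|x s - x t| <= (1 + `|v|) * `|s - t|.
Proof.
move=> /(_ 1 ltr01); apply: filterS => s h /h; rewrite mul1r => xs.
rewrite mulrDl mul1r -lerBlDr; apply: le_trans xs.
by rewrite [X in _ - X]mulrC -normrZ lerB_dist.
Qed.

Lemma slope_in_cvg {R : realType} {V : normedModType R} (J : set R)
    (x : R -> V) (t : R) (v : V) (e : R) : slope_in J x t v -> 0 < e ->
  \forall s \near t, J s -> `|x s - x t| < e.
Proof.
move=> /slope_in_lipschitz lip e0.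
have v0 : 0 < 1 + `|v| by rewrite ltr_pwDl.
apply: filterS2 lip (nbhsx_ballx t _ (divr_gt0 e0 v0)) => s xs.
rewrite -ball_normE /= distrC => st Js.
by apply: le_lt_trans (xs Js) _; rewrite mulrC -ltr_pdivlMr.
Qed.

(** The mean value theorem: inside [[a, b]] the relative derivative is the
    two-sided one. *)
Lemma slope0_constant {R : realType} (phi : R -> R^o) (a b : R) : a <= b ->
  (forall t, a <= t <= b -> slope_in [set s | a <= s <= b] phi t 0) ->
  phi b = phi a.
Proof.
move=> ab phi0.
have dphi t : t \in `]a, b[ -> is_derive t 1 phi 0.
  move=> tab; have tJ : a <= t <= b.
    by move: tab; rewrite in_itv /= => /andP[/ltW -> /ltW ->].
  have cv : h^-1 *: ((phi \o shift t) (h *: (1 : R)) - phi t)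
      @[h --> (0 : R)^'] --> (0 : R^o).
    apply/cvgrPdist_le => e e0; rewrite near_withinE.
    have : \forall s \near t, `|phi s - phi t| <= e * `|s - t|.
      apply: filterS2 (phi0 t tJ e e0) (near_in_itvoo tab) => s h.
      rewrite in_itv /= => /andP[as_ sb].
      by move: h; rewrite scaler0 subr0; apply; rewrite /= !ltW.
    move=> /nbhs0P; apply: filterS => h; rewrite addrAC subrr add0r => ph h0.
    rewrite sub0r normrN normrZ normfV ler_pdivrMl ?normr_gt0 //.
    by rewrite [leRHS]mulrC /= [h *: 1]mulr1 [h + t]addrC.
  by split; [apply/cvg_ex; exists 0|exact: cvg_lim].
have cphi : {within `[a, b], continuous phi}.
  apply/subspace_continuousP => t; rewrite /= in_itv /= => tJ.
  apply/cvgrPdist_lt => e e0; rewrite near_withinE.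
  apply: filterS (slope_in_cvg _ _ _ _ _ (phi0 t tJ) e0) => s h sJ.
  by rewrite distrC; apply: h; rewrite /= in_itv /= in sJ.
have [c _] := MVT_segment ab dphi cphi.
by rewrite mul0r => /subr0_eq.
Qed.

(** * Differentiability from continuous partial derivatives *)

Lemma partial_mean_value {R : realType} {n : nat} (F : 'rV[R]_n -> R)
    (i : 'I_n) (z : 'rV[R]_n) (a : R) :
  class_C1 F -> exists c, `|c| <= `|a| /\
    F (z + a *: delta_mx ord0 i) - F z
      = a * partial i F (z + c *: delta_mx ord0 i).
Proof.
move=> F1; pose phi (u : R) := F (z + u *: delta_mx ord0 i).
have dphi (u : R) :
    is_derive u 1 phi (partial i F (z + u *: delta_mx ord0 i)).
  have quotE : (fun h : R => h^-1 *: ((F \o shift (z + u *: delta_mx ord0 i))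
      (h *: delta_mx ord0 i) - F (z + u *: delta_mx ord0 i)))
      = (fun h : R => h^-1 *: ((phi \o shift u) (h *: (1 : R)) - phi u)).
    apply/funext => h; rewrite /phi /= [h *: 1]mulr1.
    by rewrite scalerDl addrCA.
  split; last by rewrite /partial /derive quotE.
  by have := (F1 i).1 (z + u *: delta_mx ord0 i); rewrite /derivable quotE.
have cphi (A : set R) : {within A, continuous phi}.
  apply: continuous_subspaceT => u; apply: differentiable_continuous.
  by apply/derivable1_diffP; exact: (@ex_derive _ _ _ _ _ _ _ (dphi u)).
have [a0|a0] := leP 0 a.
  have [c] := MVT_segment a0 (fun u _ => dphi u) (cphi _).
  rewrite in_itv /= => /andP[c0 ca] e; exists c.
  rewrite !ger0_norm //; split => //.
  by move: e; rewrite subr0 mulrC => <-; rewrite /phi scale0r addr0.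
have [c] := MVT_segment (ltW a0) (fun u _ => dphi u) (cphi _).
rewrite in_itv /= => /andP[ca c0] e; exists c.
rewrite !ler0_norm ?lerN2 ?(ltW a0) //; split => //.
move: e; rewrite sub0r mulrN [_ * a]mulrC => /(congr1 -%R).
by rewrite opprK opprB => <-; rewrite /phi scale0r addr0.
Qed.

Definition dot {R : realType} {n : nat} (u v : 'rV[R]_n) : R :=
  \sum_i u ord0 i * v ord0 i.

Lemma coord_le_norm {R : realType} {n : nat} (v : 'rV[R]_n) (i : 'I_n) :
  `|v ord0 i| <= `|v|.
Proof.
rewrite [leRHS]/Num.Def.normr /= mx_normrE.
exact: (@le_bigmax_cond _ _ _ _ (ord0, i)).
Qed.

Lemma norm_le_coord {R : realType} {n : nat} (v : 'rV[R]_n) (e : R) :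
  0 <= e -> (forall i, `|v ord0 i| <= e) -> `|v| <= e.
Proof.
move=> e0 h; rewrite [leLHS]/Num.Def.normr /= mx_normrE.
by apply/bigmax_leP; split => // -[j i] _ /=; rewrite ord1.
Qed.

(** Moving from [x] to [y] one coordinate at a time, each step changes [F] by a
    partial derivative at a nearby point times the change of that coordinate;
    continuity of the partial derivatives at [x] then bounds the error. *)
Lemma C1_differential {R : realType} {n : nat} (F : 'rV[R]_n -> R)
    (x : 'rV[R]_n) (e : R) : class_C1 F -> 0 < e ->
  \forall y \near x, `|F y - F x - dot (gradient F x) (y - x)| <= e * `|y - x|.
Proof.
move=> F1 e0.
have e1 : 0 < e / n.+1%:R by rewrite divr_gt0.
have near_partial : \forall y \near x, forall i,
    `|partial i F x - partial i F y| <= e / n.+1%:R.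
  apply: (@filter_forall _ _ _ (nbhs x)) => i.
  by move/cvgrPdist_le : ((F1 i).2 x) => /(_ _ e1).
have /nbhs_ballP[r /= r0 hr] := near_partial.
apply: filterS (nbhsx_ballx x r r0) => y; rewrite -ball_normE /= => xy.
(* The first [k] coordinates have been moved from [x] to [y]. *)
pose z (k : nat) : 'rV[R]_n :=
  \row_i (if (i < k)%N then y ord0 i else x ord0 i).
have zS (k : 'I_n) : z k.+1 = z k + (y - x) ord0 k *: delta_mx ord0 k.
  apply/rowP => i; rewrite !mxE /= -val_eqE /= ltnS.
  case: ltngtP => [ik|ki|/val_inj->]; rewrite ?mulr0 ?addr0 //.
  by rewrite mulr1 addrC subrK.
have -> : F y - F x = \sum_(k < n) (F (z k.+1) - F (z k)).
  rewrite -(big_mkord xpredT (fun k => F (z k.+1) - F (z k))).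
  rewrite telescope_sumr //.
  congr (F _ - F _); apply/rowP => i; rewrite !mxE //.
  by rewrite ltn_ord.
rewrite /dot -sumrB.
have step (k : 'I_n) : `|F (z k.+1) - F (z k)
    - gradient F x ord0 k * (y - x) ord0 k| <= e / n.+1%:R * `|y - x|.
  rewrite zS; have [c [ca ->]] :=
    partial_mean_value F k (z k) ((y - x) ord0 k) F1.
  rewrite [gradient F x ord0 k]mxE mulrC -mulrBl normrM.
  rewrite ler_pM ?coord_le_norm // distrC.
  apply: (hr _ _ k); rewrite -ball_normE /=; apply: le_lt_trans xy.
  apply: norm_le_coord => // i; rewrite !mxE.
  have [ik|ik] := eqVneq i k.
    rewrite ik ltnn mulr1 opprD addrA subrr sub0r normrN (le_trans ca) //.
    by rewrite distrC coord_le_norm.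
  rewrite mulr0 addr0; case: ifP => _; last by rewrite subrr normr0.
  by have := coord_le_norm (x - y) i; rewrite !mxE.
apply: le_trans (ler_norm_sum _ _ _) _.
apply: le_trans (ler_sum _ (fun k _ => step k)) _.
rewrite sumr_const card_ord -[leLHS]mulr_natr mulrAC ler_wpM2r // mulrAC.
by rewrite ler_pdivrMr // ler_pM2l // ler_nat.
Qed.

Lemma gradient_continuous {R : realType} {n : nat} (F : 'rV[R]_n -> R)
    (x : 'rV[R]_n) : class_C1 F -> {for x, continuous (gradient F)}.
Proof.
move=> F1; apply/(@cvgrPdist_le _ _ _ (nbhs x)) => e e0.
have : \forall y \near x, forall i, `|partial i F x - partial i F y| <= e.
  apply: (@filter_forall _ _ _ (nbhs x)) => i.
  by move/cvgrPdist_le : ((F1 i).2 x) => /(_ _ e0).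
apply: filterS => y near_y; apply: norm_le_coord; first exact: ltW.
by move=> i; rewrite !mxE.
Qed.

Lemma dotDr {R : realType} {n : nat} (u v w : 'rV[R]_n) :
  dot u (v + w) = dot u v + dot u w.
Proof. by rewrite -big_split; apply: eq_bigr => i _; rewrite mxE mulrDr. Qed.

Lemma dotZr {R : realType} {n : nat} (u v : 'rV[R]_n) (a : R) :
  dot u (a *: v) = a * dot u v.
Proof. by rewrite mulr_sumr; apply: eq_bigr => i _; rewrite mxE mulrCA. Qed.

Lemma dotBr {R : realType} {n : nat} (u v w : 'rV[R]_n) :
  dot u (v - w) = dot u v - dot u w.
Proof. by rewrite dotDr -scaleN1r dotZr mulN1r. Qed.

Lemma dot_self_eq0 {R : realType} {n : nat} (u : 'rV[R]_n) :
  dot u u = 0 -> u = 0.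
Proof.
move=> /eqP; rewrite psumr_eq0 => [/allP u0|i _]; last first.
  by rewrite -expr2 sqr_ge0.
apply/rowP => i; rewrite mxE; apply/eqP.
by have := u0 i (mem_index_enum i); rewrite mulf_eq0 orbb.
Qed.

Lemma norm_dot_le {R : realType} {n : nat} (u v : 'rV[R]_n) :
  `|dot u v| <= (\sum_i `|u ord0 i|) * `|v|.
Proof.
apply: le_trans (ler_norm_sum _ _ _) _; rewrite mulr_suml.
by apply: ler_sum => i _; rewrite normrM ler_wpM2l // coord_le_norm.
Qed.

Lemma dot_cvg {R : realType} {n : nat} {T : topologicalType}
    (u v : T -> 'rV[R]_n) (p : T) :
  {for p, continuous u} -> {for p, continuous v} ->
  {for p, continuous (fun q => dot (u q) (v q))}.
Proof.
move=> cu cv; rewrite /dot.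
apply: cvg_big => [|i _]; first exact: add_continuous.
apply: cvgM.
  apply: (@continuous_comp _ _ _ u (fun w : 'rV[R]_n => w ord0 i)) => //.
  exact: coord_continuous.
apply: (@continuous_comp _ _ _ v (fun w : 'rV[R]_n => w ord0 i)) => //.
exact: coord_continuous.
Qed.

Lemma chain_rule {R : realType} {n : nat} (F : 'rV[R]_n -> R) (J : set R)
    (x : R -> 'rV[R]_n) (t : R) (v : 'rV[R]_n) :
  class_C1 F -> slope_in J x t v ->
  slope_in J (fun s => F (x s) : R^o) t (dot (gradient F (x t)) v).
Proof.
move=> F1 xv e e0; set g := gradient F (x t).
pose C := \sum_i `|g ord0 i|.
have C0 : 0 <= C by apply: sumr_ge0.
(* Half of [e] pays for the differential of [F], half for that of [x]. *)
have D0 : 0 < 2 * (1 + `|v|) by rewrite mulr_gt0 // ltr_pwDl.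
have E0 : 0 < 2 * (C + 1) by rewrite mulr_gt0 // ltr_wpDl.
have /nbhs_ballP[r /= r0 Fr] := C1_differential F (x t) _ F1 (divr_gt0 e0 D0).
have x_near := slope_in_cvg _ _ _ _ _ xv r0.
have x_lip := slope_in_lipschitz _ _ _ _ xv.
have := xv _ (divr_gt0 e0 E0).
apply: filterS3 x_near x_lip => s near_s lip_s slope_s Js.
have /Fr : ball (x t) r (x s) by rewrite -ball_normE /= distrC near_s.
move=> /=; rewrite -/g; set y := x s - x t => Fy.
have yv := slope_s Js; rewrite -/y in yv.
have -> : F (x s) - F (x t) - (s - t) *: (dot g v : R^o)
    = (F (x s) - F (x t) - dot g y) + dot g (y - (s - t) *: v).
  by rewrite [dot g (y - _)]dotBr dotZr addrA subrK.
apply: le_trans (ler_normD _ _) _.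
have -> : e * `|s - t| = e / 2 * `|s - t| + e / 2 * `|s - t|.
  by rewrite -mulrDl -splitr.
apply: lerD.
  apply: le_trans Fy _.
  have -> : e / 2 * `|s - t|
      = e / (2 * (1 + `|v|)) * ((1 + `|v|) * `|s - t|).
    by field; rewrite gt_eqF // ltr_pwDl.
  by apply: ler_wpM2l (lip_s Js); rewrite ltW // divr_gt0.
apply: le_trans (norm_dot_le _ _) _; rewrite -/C.
have -> : e / 2 * `|s - t| = (C + 1) * (e / (2 * (C + 1)) * `|s - t|).
  by field; rewrite gt_eqF // ltr_wpDl.
by rewrite ler_pM // lerDl.
Qed.

(** * Peano's existence theorem *)

Lemma fmap_ultra {T U : Type} (f : T -> U) (F : set_system T) :
  UltraFilter F -> UltraFilter (f @ F).
Proof.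
move=> FU; split=> [|G GF fG]; first exact: fmap_proper_filter.
apply/seteqP; split=> [A GA|]; last exact: fG.
have [//|FA] := in_ultra_setVsetC (f @^-1` A) FU.
have GAc : G (~` A) by exact: fG.
by have [y []] := filter_ex (filterI GA GAc).
Qed.

(** Closed balls of the space of row vectors are compact, so that an ultrafilter
    selects a limit of every bounded family without any choice of subsequences;
    a single ultrafilter thus serves all times in [euler_cvg]. *)
Lemma bounded_ultra_cvg {R : realType} {n : nat} {T : Type}
    (F : set_system T) (u : T -> 'rV[R]_n) (M : R) :
  UltraFilter F -> (forall k, `|u k| <= M) -> exists p : 'rV[R]_n, u @ F --> p.
Proof.
move=> FU uM.
have M0 : 0 < `|M| + 1 by rewrite ltr_wpDl.
have inK (y : 'rV[R]_n) :
    closed_ball 0 (`|M| + 1) y = (`|y| <= `|M| + 1) :> Prop.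
  by rewrite closed_ballE // /closed_ball_ /= sub0r normrN.
have : compact (closed_ball (0 : 'rV[R]_n) (`|M| + 1)).
  apply: bounded_closed_compact; last exact: closed_ball_closed.
  exists (`|M| + 1); split; first exact: num_real.
  by move=> a Ma y /=; rewrite inK => yM; apply: le_trans yM (ltW Ma).
rewrite compact_ultra => /(_ (u @ F) (fmap_ultra u F FU)) [].
  apply: nearW => k /=; rewrite inK (le_trans (uM k)) //.
  by rewrite ler_wpDr // ler_norm.
by move=> p [_ up]; exists p.
Qed.

Lemma ler_dist3 {R : realType} {V : normedModType R} (a b a' b' c : V) :
  `|a - b - c| <= `|a - a'| + `|b - b'| + `|a' - b' - c|.
Proof.
have -> : a - b - c = (a - a') - (b - b') + (a' - b' - c).
  rewrite opprB !addrA; congr (_ - _).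
  by rewrite [X in X - b']addrAC [X in X - b - b']addrAC subrK addrAC addrK.
by apply: le_trans (ler_normD _ _) _; rewrite lerD2r ler_normB.
Qed.

Section euler.
Context {R : realType} {n : nat} (G : R * 'rV[R]_n -> 'rV[R]_n).
Context (x0 : 'rV[R]_n).


Fixpoint euler_node (h : R) (j : nat) : 'rV[R]_n :=
  if j is i.+1 then
    let y := euler_node h i in y + h *: G (i%:R * h, y)
  else x0.

(** A step function rather than a polygon: its increments are exact sums of
    Euler steps, and its values at grid times are the nodes. *)
Definition euler (h t : R) : 'rV[R]_n := euler_node h (Num.truncn (t / h)).

Lemma euler_node_increment h m k v e : 0 < h ->
  (forall j, (m <= j < m + k)%N ->
    `|G (j%:R * h, euler_node h j) - v| <= e) ->
  `|euler_node h (m + k) - euler_node h m - (k%:R * h) *: v|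
    <= (k%:R * h) * e.
Proof.
move=> h0; elim: k => [|k IH] near_v.
  by rewrite addn0 subrr !mul0r scale0r subr0 normr0.
have -> : euler_node h (m + k.+1) - euler_node h m - (k.+1%:R * h) *: v
    = (euler_node h (m + k) - euler_node h m - (k%:R * h) *: v)
      + h *: (G ((m + k)%:R * h, euler_node h (m + k)) - v).
  rewrite addnS /= -natr1 mulrDl mul1r scalerDl scalerBr opprD !addrA.
  by congr (_ - _); rewrite [X in X - _]addrAC [LHS]addrAC.
have -> : k.+1%:R * h * e = k%:R * h * e + h * e.
  by rewrite -natr1 !mulrDl mul1r.
apply: le_trans (ler_normD _ _) _; apply: lerD.
  by apply: IH => j /andP[mj jk]; apply: near_v; rewrite mj addnS ltnS ltnW.
rewrite normrZ gtr0_norm // ler_pM2l //; apply: near_v.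
by rewrite leq_addr addnS leqnn.
Qed.

(** An increment is a sum of values of [G] weighted by [h], at the nodes between
    the two times, all of them within [e] of [v]. The grid misses each end point
    by less than [h], whence the error terms in [h]. *)
Lemma euler_increment h s t v e : 0 < h -> 0 <= e -> 0 <= s -> s <= t ->
  (forall r, 0 <= r -> s - h <= r -> r <= t ->
    `|G (r, euler h r) - v| <= e) ->
  `|euler h t - euler h s - (t - s) *: v| <= (t - s + h) * e + h * `|v|.
Proof.
move=> h0 e0 s0 st near_v.
have t0 : 0 <= t by apply: le_trans st.
have /truncn_itv := divr_ge0 s0 (ltW h0).
have /truncn_itv := divr_ge0 t0 (ltW h0).
rewrite !ler_pdivlMr // !ltr_pdivrMr //.
have : (Num.truncn (s / h) <= Num.truncn (t / h))%N.
  by rewrite le_truncn // ler_pM2r // invr_gt0.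
rewrite /euler; set m := Num.truncn (s / h) => mt.
rewrite -(subnKC mt); set k := (_ - m)%N.
move=> /andP[kt tk] /andP[ms sm].
rewrite -?natr1 ?natrD !mulrDl ?mul1r in kt tk sm.
have near_node j : (m <= j < m + k)%N ->
    `|G (j%:R * h, euler_node h j) - v| <= e.
  move=> /andP[mj jk].
  have -> : euler_node h j = euler h (j%:R * h).
    by rewrite /euler mulfK ?gt_eqF // natrK.
  have mjh : m%:R * h <= j%:R * h by rewrite ler_pM2r // ler_nat.
  have jkh : j%:R * h <= (m + k)%:R * h by rewrite ler_pM2r // ler_nat ltnW.
  apply: near_v.
  - by rewrite mulr_ge0 // ltW.
  - lra.
  - by apply: le_trans jkh _; rewrite natrD mulrDl.
have kh_le : k%:R * h * e <= (t - s + h) * e by rewrite ler_wpM2r //; lra.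
have -> : euler_node h (m + k) - euler_node h m - (t - s) *: v
    = (euler_node h (m + k) - euler_node h m - (k%:R * h) *: v)
      + (k%:R * h - (t - s)) *: v.
  by rewrite [(_ - (t - s)) *: v]scalerBl addrA subrK.
apply: le_trans (ler_normD _ _) _; apply: lerD.
  by apply: (le_trans _ kh_le); exact: euler_node_increment.
rewrite normrZ ler_wpM2r // ler_norml; apply/andP; split; lra.
Qed.

Context (L : R) (G_le : forall p, `|G p| <= L).

Let L_ge0 : 0 <= L. Proof. exact: le_trans (normr_ge0 _) (G_le (0, 0)). Qed.


(** The case [v = 0] of [euler_increment]. *)
Lemma euler_lipschitz h s t : 0 < h -> 0 <= s -> 0 <= t ->
  `|euler h t - euler h s| <= (`|t - s| + h) * L.
Proof.
move=> h0; wlog st : s t / s <= t => [wl s0 t0|s0 t0].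
  have [/wl|/ltW/wl] := leP s t; first exact.
  by rewrite distrC [`|t - s|]distrC; exact.
have := @euler_increment h s t 0 L h0 L_ge0 s0 st.
rewrite scaler0 subr0 normr0 mulr0 addr0 ger0_norm ?subr_ge0 //; apply.
by move=> r _ _ _; rewrite subr0.
Qed.

Lemma euler_cvg (U : set_system nat) : UltraFilter U ->
  exists x : R -> 'rV[R]_n, forall t e, 0 <= t -> 0 < e ->
    \forall k \near U, `|x t - euler k.+1%:R^-1 t| <= e.
Proof.
move=> UU.
have pointwise (t : R) : exists p : 'rV[R]_n, 0 <= t ->
    (fun k : nat => euler k.+1%:R^-1 t) @ U --> p.
  have [t0|] := leP 0 t; last by exists 0.
  have [|p up] := bounded_ultra_cvg U (fun k : nat => euler k.+1%:R^-1 t)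
    (`|x0| + (t + 1) * L) UU; last by exists p.
  move=> k; have h0 : 0 < k.+1%:R^-1 :> R by rewrite invr_gt0.
  have := euler_lipschitz _ _ _ h0 (lexx 0) t0.
  have -> : euler k.+1%:R^-1 0 = x0 by rewrite /euler mul0r truncn0.
  rewrite subr0 ger0_norm // => lip.
  rewrite -lerBlDl; apply: le_trans (lerB_dist _ _) _; apply: le_trans lip _.
  by rewrite ler_wpM2r // lerD2l invf_le1 // ler1n.
have [x xP] := choice pointwise.
by exists x => t e t0 e0; move/cvgrPdist_le : (xP t t0) => /(_ _ e0).
Qed.

(** The derivative is asserted only where [G] is continuous at a point of the
    graph: this allows a field that has been cut off to make it bounded, at the
    price of discontinuities. At such a point [t], the approximations stay in a
    neighbourhood where [G] is within [e] of its value [v], by their Lipschitz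
    bound; [euler_increment] then compares their increments with those of the
    line of slope [v]. Each inequality involves finitely many times, so one
    index of the ultrafilter serves them all. *)
Lemma peano : exists x : R -> 'rV[R]_n,
  [/\ x 0 = x0,
      forall s t, 0 <= s -> 0 <= t -> `|x t - x s| <= L * `|t - s| &
      forall t, 0 <= t -> {for (t, x t), continuous G} ->
        slope_in [set s | 0 <= s] x t (G (t, x t))].
Proof.
have [U [UU oo_U]] := @ultraFilterLemma _ \oo eventually_filter.
have [x xU] := euler_cvg U UU.
have small e : 0 < e -> \forall k \near U, k.+1%:R^-1 <= e :> R.
  move=> e0; apply: oo_U.
  by apply: filterS (near_infty_natSinv_lt (PosNum e0)) => k /ltW.
exists x; split.
- apply/eqP; rewrite -subr_eq0 -normr_le0; apply/ler_addgt0Pr => e e0.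
  have [k] := filter_ex (xU 0 e (lexx 0) e0).
  by rewrite add0r /euler mul0r truncn0.
- move=> s t s0 t0; apply/ler_addgt0Pr => e e0.
  pose d := e / (2 + L).
  have d0 : 0 < d by rewrite divr_gt0 // ltr_wpDr.
  have [k [[xs xt] hd]] := filter_ex (filterI
    (filterI (xU s d s0 d0) (xU t d t0 d0)) (small d d0)).
  have h0 : 0 < k.+1%:R^-1 :> R by rewrite invr_gt0.
  move: xs xt hd h0 => /=; set h := k.+1%:R^-1 => xs xt hd h0.
  have lip := euler_lipschitz _ _ _ h0 s0 t0.
  have eE : e = 2 * d + d * L by rewrite /d; field; rewrite gt_eqF // ltr_wpDr.
  have dL : h * L <= d * L by rewrite ler_wpM2r.
  have := ler_dist3 (x t) (x s) (euler h t) (euler h s) 0.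
  clearbody d h; rewrite !subr0; lra.
- move=> t t0 /cvgrPdist_le Gc e e0.
  have /nbhs_ballP[dl /= dl0 Gdl] := Gc e e0.
  (* With all times and values within [rho], the graph of an approximation stays
     at distance at most [2 * rho] in time and [(3 * L + 1) * rho] in space. *)
  pose rho := dl / (3 * L + 4).
  have den0 : 0 < 3 * L + 4 by have := L_ge0; lra.
  have rho0 : 0 < rho by rewrite divr_gt0.
  have dlE : dl = 3 * (rho * L) + 4 * rho.
    by rewrite /rho; field; rewrite gt_eqF.
  have rhoL0 : 0 <= rho * L by rewrite mulr_ge0 // ltW.
  set v := G (t, x t).
  have forward a b : 0 <= a -> a <= b -> `|a - t| < rho -> `|b - t| < rho ->
      `|x b - x a - (b - a) *: v| <= e * (b - a).
    move=> a0 ab at_ bt; have b0 := le_trans a0 ab.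
    apply/ler_addgt0Pr => eta eta0.
    pose d := Num.min rho (eta / (2 + e + `|v|)).
    have den1 : 0 < 2 + e + `|v| by have := normr_ge0 v; lra.
    have d0 : 0 < d by rewrite lt_min rho0 divr_gt0.
    have d_rho : d <= rho by rewrite ge_min lexx.
    have d_eta : d * (2 + e + `|v|) <= eta.
      by rewrite -ler_pdivlMr // ge_min lexx orbT.
    have [k [[[xa xb] xt] hd]] := filter_ex (filterI (filterI (filterI
      (xU a d a0 d0) (xU b d b0 d0)) (xU t rho t0 rho0)) (small d d0)).
    have : 0 < k.+1%:R^-1 :> R by rewrite invr_gt0.
    move: xa xb xt hd => /=; set h := k.+1%:R^-1 => xa xb xt hd h0.
    have near_v r : 0 <= r -> a - h <= r -> r <= b ->
        `|G (r, euler h r) - v| <= e.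
      move=> r0 ar rb; rewrite distrC; apply: (Gdl (r, _)).
      move: at_ bt; rewrite !ltr_norml => /andP[at1 at2] /andP[bt1 bt2].
      have tr : `|t - r| <= 2 * rho.
        by rewrite ler_norml; apply/andP; split; lra.
      split; rewrite -ball_normE /=; first by lra.
      have lip := euler_lipschitz h r t h0 r0 t0.
      have lip' : (`|t - r| + h) * L <= 3 * rho * L.
        by rewrite ler_wpM2r //; lra.
      have := ler_distD (euler h t) (x t) (euler h r).
      by clearbody h rho; lra.
    have := euler_increment h a b v e h0 (ltW e0) a0 ab near_v.
    have hb : h * (e + `|v|) <= d * (e + `|v|).
      by rewrite ler_wpM2r // addr_ge0 // ltW.
    have := ler_dist3 (x b) (x a) (euler h b) (euler h a) ((b - a) *: v).
    by clearbody d h; lra.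
  apply: filterS (nbhsx_ballx t rho rho0) => s; rewrite -ball_normE /= => ts s0.
  have tt : `|t - t| < rho by rewrite subrr normr0.
  have [st|/ltW ts'] := leP t s.
    by rewrite [`|s - t|]ger0_norm ?subr_ge0 // forward // distrC.
  rewrite [`|s - t|]ler0_norm ?subr_le0 // opprB.
  have -> : x s - x t - (s - t) *: v = - (x t - x s - (t - s) *: v).
    by rewrite opprB opprB addrC -scaleNr opprB.
  by rewrite normrN forward // distrC.
Qed.

End euler.


(** * Tangency of the frozen fields *)

Lemma time_domain_sub {R : realType} (J : set R) (s t : R) :
  time_domain J -> J t -> 0 <= s -> s <= t -> J s.
Proof. by case=> itvJ _ J0 _ Jt s0 st; apply: (itvJ 0 t); rewrite ?s0. Qed.

Lemma is_solution_slope {R : realType} {n : nat}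
    (g : R -> 'rV[R]_n -> 'rV[R]_n) (J : set R) (x : R -> 'rV[R]_n) :
  is_solution g J x <->
  time_domain J /\ forall t, J t -> slope_in J x t (g t (x t)).
Proof.
by split=> -[dJ xg]; split=> // t Jt; apply/slope_inP; exact: xg.
Qed.

(** By uniqueness, all solutions with a given initial value agree on common
    times; their union is the maximal one. At a time [t] of the union some single
    solution is defined at all times of the union near [t], namely one defined at
    a later time, or any one defined at [t] if there is no later time; hence the
    union has the right derivative at [t]. *)
Lemma maximal_extension {R : realType} {n : nat}
    (g : R -> 'rV[R]_n -> 'rV[R]_n) (J : set R) (x : R -> 'rV[R]_n) :
  solutions_unique g -> is_solution g J x ->
  exists K z, is_maximal_solution g K z /\ z 0 = x 0.
Proof.
move=> uniq_g xJ.
pose through (t : R) (v : 'rV[R]_n) := exists L y,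
  [/\ is_solution g L y, y 0 = x 0, L t & v = y t].
pose K : set R := [set t | exists v, through t v].
have [|z zP] := @choice _ _ (fun t v => K t -> through t v).
  by move=> t; have [[v tv]|nK] := pselect (K t); [exists v|exists 0].
have agree L y t : is_solution g L y -> y 0 = x 0 -> L t -> K t /\ z t = y t.
  move=> yL y0 Lt; have Kt : K t by exists (y t), L, y.
  split=> //; have [L' [y' [yL' y'0 L't ->]]] := zP t Kt.
  by apply: (uniq_g _ _ _ _ yL' yL) => //; rewrite y'0 y0.
have dJ := xJ.1; have J0 : J 0 by case: dJ.
have [K0 z0] := agree _ _ _ xJ erefl J0.
exists K, z; split=> //; split; last first.
  move=> L y yL KL yz t Lt.
  have y0 : y 0 = x 0 by rewrite yz.
  by have [] := agree L y t yL y0 Lt.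
have K_sub s t : K t -> 0 <= s -> s <= t -> K s.
  move=> [v [L [y [yL y0 Lt _]]]] s0 st.
  by have [] := agree L y s yL y0 (time_domain_sub _ _ _ yL.1 Lt s0 st).
have K_ge0 t : K t -> 0 <= t.
  by move=> [v [L [y [[[_ L_ge0 _ _] _] _ Lt _]]]]; exact: L_ge0.
apply/is_solution_slope; split.
  split=> //.
    by move=> s t Ks Kt u /andP[su ut]; apply: (K_sub u t Kt) => //;
      apply: le_trans su; exact: K_ge0.
  case: dJ => _ _ _ [t Jt t0]; exists t => //.
  by have [] := agree _ _ _ xJ erefl Jt.
move=> t Kt.
have [L [y [yL y0 Lt K_near]]] : exists L y, [/\ is_solution g L y, y 0 = x 0,
    L t & \forall s \near t, K s -> L s].
  have [[u [Ku tu]]|no_later] := pselect (exists u, K u /\ t < u).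
    have [v [L [y [yL y0 Lu _]]]] := Ku.
    have Lsub s : 0 <= s -> s <= u -> L s by exact: time_domain_sub yL.1 Lu.
    exists L, y; split=> //; first by apply: Lsub; [exact: K_ge0|exact: ltW].
    have ut0 : 0 < u - t by rewrite subr_gt0.
    apply: filterS (nbhsx_ballx t _ ut0) => s; rewrite -ball_normE /= => ts Ks.
    apply: Lsub; first exact: K_ge0.
    by move: ts; rewrite ltr_norml => /andP[ts _]; lra.
  have [v [L [y [yL y0 Lt _]]]] := Kt; exists L, y; split=> //.
  apply: (@nearW _ (nbhs t)) => s Ks.
  apply: (time_domain_sub _ _ _ yL.1 Lt (K_ge0 _ Ks)).
  by rewrite leNgt; apply/negP => ts; apply: no_later; exists s.
have [_ zt] := agree _ _ _ yL y0 Lt; rewrite zt.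
have /is_solution_slope[_ /(_ t Lt)] := yL; apply: slope_in_near => //.
apply: filterS K_near => s KL /KL Ls; split=> //.
by have [] := agree _ _ _ yL y0 Ls.
Qed.

(** Along the maximal solution from [x0] the function [F] vanishes, so its right
    derivative at time 0, which the chain rule computes, is 0. *)
Lemma flow_invariant_tangent {R : realType} {n : nat} (F : 'rV[R]_n -> R)
    (g : R -> 'rV[R]_n -> 'rV[R]_n) (x0 : 'rV[R]_n) :
  class_C1 F -> well_posed g -> flow_invariant g (zero_set F) ->
  F x0 = 0 -> dot (gradient F x0) (g 0 x0) = 0.
Proof.
move=> F1 [ex_g uniq_g] inv Fx0.
have [J [x [xJ x00]]] := ex_g x0.
have [K [z [zK]]] := maximal_extension _ _ _ uniq_g xJ; rewrite x00 => z0.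
have Fz t : K t -> F (z t) = 0 by apply: (inv K z zK); rewrite z0.
have /is_solution_slope[dK zg] := zK.1.
have [_ _ K0 [tau Ktau tau0]] := dK.
have := chain_rule _ _ _ _ _ F1 (zg 0 K0); rewrite z0.
set c := dot _ _ => slope_c.
apply/eqP; rewrite -normr_le0; apply/ler_addgt0Pr => e e0; rewrite add0r.
have /nbhs_ballP[r /= r0 near_c] := slope_c e e0.
pose s := Num.min tau (r / 2).
have s0 : 0 < s by rewrite lt_min tau0 divr_gt0.
have Ks : K s.
  by apply: time_domain_sub Ktau (ltW s0) _ => //; rewrite /s ge_min lexx.
have sr : s < r by rewrite /s gt_min; apply/orP; right; lra.
have := near_c s; rewrite /= -ball_normE /= sub0r normrN (gtr0_norm s0).
move=> /(_ sr Ks).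
rewrite !Fz // !subr0 sub0r normrN normrZ gtr0_norm // mulrC.
by rewrite ler_pM2r.
Qed.

(** * Solutions inside a level set *)

Section projection.
Context {R : realType} {n : nat} (F : 'rV[R]_n -> R) (F1 : class_C1 F).
Context (G : R * 'rV[R]_n -> 'rV[R]_n) (G_cont : continuous G).


(** Where the gradient is not zero, the part of [G] tangent to the level sets of
    [F]. *)
Definition projected_field (p : R * 'rV[R]_n) : 'rV[R]_n :=
  let g := gradient F p.2 in G p - (dot g (G p) / dot g g) *: g.

Lemma gradient_snd_continuous (p : R * 'rV[R]_n) :
  {for p, continuous (fun q : R * 'rV[R]_n => gradient F q.2)}.
Proof.
apply: (@continuous_comp _ _ _ snd (gradient F)); first exact: cvg_snd.
exact: gradient_continuous.
Qed.

Lemma projected_field_cont (p : R * 'rV[R]_n) :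
  gradient F p.2 != 0 -> {for p, continuous projected_field}.
Proof.
move=> gp0; have cg := gradient_snd_continuous p.
have gg0 : dot (gradient F p.2) (gradient F p.2) != 0.
  by apply/eqP => /dot_self_eq0 gp; rewrite gp eqxx in gp0.
have cgG := dot_cvg _ _ _ cg (G_cont p); have cgg := dot_cvg _ _ _ cg cg.
exact: (cvgB (G_cont p) (cvgZ (cvgM cgG (cvgV gg0 cgg)) cg)).
Qed.

Lemma projected_field_orthogonal (p : R * 'rV[R]_n) :
  gradient F p.2 != 0 -> dot (gradient F p.2) (projected_field p) = 0.
Proof.
move=> gp0; rewrite dotBr dotZr divfK ?subrr //.
by apply/eqP => /dot_self_eq0 gp; rewrite gp eqxx in gp0.
Qed.

Lemma projected_fieldE (p : R * 'rV[R]_n) :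
  dot (gradient F p.2) (G p) = 0 -> projected_field p = G p.
Proof. by move=> gG; rewrite /projected_field gG mul0r scale0r subr0. Qed.

(** Peano's theorem needs a bounded field. The projected field is replaced by 0
    where its norm reaches [L], a bound that it satisfies strictly near
    [(0, x0)], so that the cut-off field is continuous there; the solution stays
    near [x0] for a short time by its Lipschitz bound. *)
Lemma level_set_viable (x0 : 'rV[R]_n) : gradient F x0 != 0 ->
  (forall t x, 0 <= t -> F x = F x0 -> dot (gradient F x) (G (t, x)) = 0) ->
  exists (d : R) (y : R -> 'rV[R]_n), [/\ 0 < d, y 0 = x0 &
    forall t, 0 <= t <= d -> F (y t) = F x0 /\
      slope_in [set s | 0 <= s <= d] y t (G (t, y t))].
Proof.
move=> g0 tangent.
pose L := `|projected_field (0, x0)| + 1.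
have L1 : 1 <= L by rewrite lerDr.
pose good := [set p | gradient F p.2 != 0 /\ `|projected_field p| < L].
pose H p := if `|projected_field p| < L then projected_field p else 0.
have HL p : `|H p| <= L.
  by rewrite /H; case: ifP => [/ltW //|_]; rewrite normr0 (le_trans _ L1).
have near_good : nbhs (0, x0) good.
  have cP := projected_field_cont (0, x0) g0.
  have cg := gradient_snd_continuous (0, x0).
  have g0' : 0 < `|gradient F x0| by rewrite normr_gt0.
  move/cvgrPdist_lt: cP => /(_ _ ltr01) near_P.
  move/cvgrPdist_lt: cg => /(_ _ g0') near_g.
  apply: filterS2 near_P near_g => q Pq gq; split.
    by apply/negP => /eqP gq0; move: gq; rewrite gq0 subr0 ltxx.
  rewrite /L -ltrBlDl; apply: le_lt_trans Pq.
  by rewrite [leRHS]distrC; exact: lerB_dist.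
have H_cont p : nbhs p good -> {for p, continuous H} /\ H p = projected_field p.
  move=> gp; have [gp0 pL] := nbhs_singleton gp.
  have Hp : H p = projected_field p by rewrite /H pL.
  split=> //; rewrite /prop_for /continuous_at Hp.
  apply: cvg_trans (projected_field_cont p gp0).
  by apply: near_eq_cvg; apply: filterS gp => q [_ qL]; rewrite /H qL.
have [y [y0 y_lip y_slope]] := peano H x0 L HL.
have /nbhs_ballP[r /= r0 r_good] := nbhs_interior near_good.
(* As [1 <= L], both [d] and the displacement [L * d] are less than [r]. *)
pose d := r / (L + 1).
have d0 : 0 < d by rewrite divr_gt0 //; lra.
have dE : d * L + d = r by rewrite /d; field; rewrite gt_eqF //; lra.
have dL : d <= d * L by rewrite ler_peMr // ltW.
have y_good t : 0 <= t <= d -> nbhs (t, y t) good.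
  move=> /andP[t0 td]; apply: r_good; split; rewrite -ball_normE /=.
    by rewrite sub0r normrN ger0_norm //; lra.
  have := y_lip t 0 t0 (lexx 0); rewrite y0 sub0r normrN ger0_norm //.
  have : L * t <= d * L by rewrite mulrC ler_wpM2r //; lra.
  by lra.
have sub : [set s | 0 <= s <= d] `<=` [set s | 0 <= s] by move=> s /andP[].
have slope t : 0 <= t <= d ->
    slope_in [set s | 0 <= s <= d] y t (projected_field (t, y t)).
  move=> td; have [cH <-] := H_cont _ (y_good t td).
  have t0 : 0 <= t by case/andP: td.
  apply: slope_in_near (y_slope t t0 cH) => //.
  by apply: (@nearW _ (nbhs t)) => s /sub.
exists d, y; split=> // t td.
have Fy : F (y t) = F x0.
  rewrite -y0; apply: (@slope0_constant _ (fun s => F (y s)) 0 t).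
    by case/andP: td.
  move=> s /andP[s0 st]; have sd : 0 <= s <= d.
    by rewrite s0 (le_trans st) //; case/andP: td.
  have := chain_rule _ _ _ _ _ F1 (slope s sd).
  rewrite (@projected_field_orthogonal (s, y s)); last first.
    by have [] := nbhs_singleton (y_good s sd).
  apply: slope_in_near => //; apply: (@nearW _ (nbhs s)) => u /= /andP[u0 ut].
  by split=> //; rewrite u0 (le_trans ut) //; case/andP: td.
split=> //; rewrite -projected_fieldE; first exact: slope.
by apply: tangent => //; case/andP: td.
Qed.

End projection.


(** * Invariance under time-dependent fields *)

(** The field [g] is compared with a continuous [G] at nonnegative times only,
    because a sample path is given, and continuous, only there. The argument is
    by contradiction at the supremum [a] of the zeros of [F] along [x] up to a
    time at which [x] is outside [M]: the solution [z] follows [x] up to [a],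
    then one from [level_set_viable]. *)
Lemma tangent_field_invariant {R : realType} {n : nat} (F : 'rV[R]_n -> R)
    (G : R * 'rV[R]_n -> 'rV[R]_n) (g : R -> 'rV[R]_n -> 'rV[R]_n)
    (J : set R) (x : R -> 'rV[R]_n) :
  class_C1 F -> normal_gradient F -> continuous G ->
  (forall t y, 0 <= t -> g t y = G (t, y)) ->
  (forall t y, 0 <= t -> zero_set F y -> dot (gradient F y) (G (t, y)) = 0) ->
  solutions_unique g -> is_solution g J x -> zero_set F (x 0) ->
  forall t, J t -> zero_set F (x t).
Proof.
move=> F1 F_normal G_cont gG tangent uniq_g xJ Fx0 t1 Jt1.
apply: contrapT => Fxt1.
have /is_solution_slope[dJ x_slope] := xJ.
have t1_ge0 : 0 <= t1 by case: dJ => _ J_ge0 _ _; exact: J_ge0.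
pose A := [set t | 0 <= t <= t1 /\ F (x t) = 0].
have A0 : A 0 by split=> //; rewrite lexx.
have A_ub : ubound A t1 by move=> t [/andP[]].
have supA : has_sup A by split; [exists 0|exists t1].
pose a := sup A.
have a0 : 0 <= a by exact: (sup_upper_bound supA).
have at1 : a <= t1 by apply: ge_sup => //; exists 0.
have Ja : J a by exact: time_domain_sub dJ Jt1 a0 at1.
(* A supremum of zeros is a zero by continuity. *)
have Fxa : F (x a) = 0.
  apply: contrapT => /eqP Fxa; have Fxa0 : 0 < `|F (x a)| by rewrite normr_gt0.
  have /nbhs_ballP[r /= r0 near_Fxa] :=
    slope_in_cvg _ _ _ _ _ (chain_rule _ _ _ _ _ F1 (x_slope a Ja)) Fxa0.
  have [s [/andP[s0 st1] Fxs] as_] := sup_adherent r0 supA.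
  have sa : s <= a by apply: (sup_upper_bound supA); rewrite /A /= s0 st1.
  have as_r : `|a - s| < r.
    by rewrite ger0_norm ?subr_ge0 //; rewrite -/a in as_; lra.
  have Js : J s by exact: time_domain_sub dJ Jt1 s0 st1.
  have := near_Fxa s; rewrite /= -ball_normE /= Fxs sub0r normrN ltxx.
  by move=> /(_ as_r Js).
have {at1} at1 : a < t1.
  by rewrite lt_neqAle at1 andbT; apply/eqP => e; apply: Fxt1; rewrite -e.
pose Ga (p : R * 'rV[R]_n) := G (a + p.1, p.2).
have Ga_cont : continuous Ga.
  move=> p; apply: (@continuous_comp _ _ _
    (fun q : R * 'rV[R]_n => (a + q.1, q.2)) G); last exact: G_cont.
  have shift_cont : {for p, continuous (fun q : R * 'rV[R]_n => a + q.1)}.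
    by apply: cvgD; [exact: cvg_cst|exact: cvg_fst].
  exact: cvg_pair shift_cont cvg_snd.
have [|d [y [d0 y0 y_sol]]] :=
  level_set_viable F F1 Ga Ga_cont (x a) (F_normal _ Fxa).
  by move=> t z t0; rewrite Fxa => Fz; apply: tangent => //; rewrite addr_ge0.
pose z t := if t <= a then x t else y (t - a).
have z_right t : a <= t -> z t = y (t - a).
  rewrite /z; case: ifP => // ta at_.
  by have -> : t = a by [apply/le_anti/andP]; rewrite subrr y0.
have z_left t : t <= a -> z t = x t by rewrite /z => ->.
pose K := [set t | 0 <= t <= a + d].
have z_slope_left t : 0 <= t <= a ->
    slope_in [set s | 0 <= s <= a] z t (g t (z t)).
  move=> /andP[t0 ta]; rewrite z_left //.
  have Jt : J t by exact: time_domain_sub dJ Ja t0 ta.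
  apply: slope_in_near (x_slope t Jt); last exact: z_left.
  apply: (@nearW _ (nbhs t)) => s /= /andP[s0 sa]; split; last exact: z_left.
  exact: time_domain_sub dJ Ja s0 sa.
have z_slope_right t : a <= t <= a + d ->
    slope_in [set s | a <= s <= a + d] z t (g t (z t)).
  move=> /andP[at_ td].
  have tad : 0 <= t - a <= d by apply/andP; split; lra.
  have [_ /slope_in_shift] := y_sol (t - a) tad.
  rewrite /Ga /= [a + _]addrC subrK -gG ?(le_trans a0) // -z_right //.
  apply: slope_in_near; last exact: z_right.
  apply: (@nearW _ (nbhs t)) => s /= /andP[sa sd]; split; last exact: z_right.
  by apply/andP; split; lra.
have zK : is_solution g K z.
  apply/is_solution_slope; split.
    split.
    - move=> s t /andP[s0 sd] /andP[t0 td] u /andP[su ut].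
      by rewrite /K /= (le_trans s0 su) (le_trans ut td).
    - by move=> t /andP[].
    - by rewrite /K /= lexx addr_ge0 // ltW.
    - by exists (a + d); rewrite /K /= ?lexx ?andbT ?addr_ge0 ?ltr_wpDl // ltW.
  move=> t /andP[t0 td]; have [ta|ta|ta] := ltgtP t a.
  - have tJ : 0 <= t <= a by rewrite t0 ltW.
    apply: slope_in_near (z_slope_left t tJ) => //.
    have ta0 : 0 < a - t by rewrite subr_gt0.
    apply: filterS (nbhsx_ballx t _ ta0) => s; rewrite -ball_normE /=.
    rewrite ltr_norml => /andP[ts _] /andP[s0 _]; split=> //.
    by rewrite s0; lra.
  - have tJ : a <= t <= a + d by rewrite td ltW.
    apply: slope_in_near (z_slope_right t tJ) => //.
    have ta0 : 0 < t - a by rewrite subr_gt0.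
    apply: filterS (nbhsx_ballx t _ ta0) => s; rewrite -ball_normE /=.
    rewrite ltr_norml => /andP[_ ts] /andP[_ sd]; split=> //.
    by rewrite sd andbT; lra.
  - have tl : 0 <= t <= a by rewrite t0 ta lexx.
    have tr : a <= t <= a + d by rewrite td ta lexx.
    apply: slope_in_near (slope_inU _ _ _ _ _ (z_slope_left t tl)
      (z_slope_right t tr)) => //.
    apply: (@nearW _ (nbhs t)) => s /andP[s0 sd]; split=> //=.
    by have [sa|/ltW sa] := leP s a; [left; rewrite s0|right; rewrite sd sa].
pose t2 := Num.min t1 (a + d).
have at2 : a < t2 by rewrite /t2 lt_min at1 ltrDl.
have t2t1 : t2 <= t1 by rewrite /t2 ge_min lexx.
have t2d : t2 <= a + d by rewrite /t2 ge_min lexx orbT.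
have t2_ge0 : 0 <= t2 by lra.
have xz : x t2 = z t2.
  apply: (uniq_g _ _ _ _ xJ zK); first by rewrite z_left.
    exact: time_domain_sub dJ Jt1 t2_ge0 t2t1.
  by rewrite /K /= t2_ge0.
have At2 : A t2.
  split; first by rewrite t2_ge0.
  rewrite xz z_right ?ltW //.
  have t2ad : 0 <= t2 - a <= d by apply/andP; split; lra.
  by have [-> _] := y_sol _ t2ad.
have := sup_upper_bound supA At2; rewrite -/a; lra.
Qed.

(** Extending a path by its initial value to negative times gives a field that is
    continuous on the whole time axis, as [peano] requires near time 0. *)
Lemma continuous_clamp {R : realType} {T : topologicalType} (eta : R -> T) :
  {within [set t | 0 <= t], continuous eta} ->
  continuous (fun t : R => eta (Num.max 0 t)).
Proof.
move=> /subspace_continuousP eta_cont t.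
have m0 : 0 <= Num.max 0 t by rewrite le_max lexx.
have max_cont : (fun s : R => Num.max 0 s) @ t --> Num.max 0 t.
  by apply: (@continuous_max _ _ (fun=> 0) id);
    [exact: cst_continuous|exact: cvg_id].
move=> U /(eta_cont _ m0) near_U.
have near_t : \forall s \near t, 0 <= Num.max 0 s -> U (eta (Num.max 0 s)).
  exact: max_cont near_U.
by apply: filterS near_t => s; apply; rewrite le_max lexx.
Qed.

Theorem theorem4p5 (R : realType) (n d : nat)
    (F : 'rV[R]_n -> R) (F_C2 : class_C2 F) (F_normal : normal_gradient F)
    (f : 'rV[R]_n * 'rV[R]_d -> 'rV[R]_n) (f_cont : continuous f)
    (f_wp : forall e : 'rV[R]_d, well_posed (fun (_ : R) x => f (x, e)))
    (f_inv : forall e : 'rV[R]_d,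
      flow_invariant (fun (_ : R) x => f (x, e)) (zero_set F))
    (dO : measure_display) (Omega : measurableType dO) (P : probability Omega R)
    (eta : R -> Omega -> 'rV[R]_d) (eta_proc : continuous_process eta)
    (eta_wp : {ae P, forall w, well_posed (rode f eta w)}) :
  {ae P, forall w, forall (J : set R) (x : R -> 'rV[R]_n),
    is_solution (rode f eta w) J x -> zero_set F (x 0) ->
    forall t, J t -> zero_set F (x t)}.
Proof.
apply: filterS eta_wp => w [_ uniq_w] J x.
pose G (p : R * 'rV[R]_n) := f (p.2, eta (Num.max 0 p.1) w).
apply: (tangent_field_invariant F G) => //.
- by case: F_C2.
- have eta_cont := continuous_clamp _ (eta_proc.2 w).
  move=> p; apply: (@continuous_comp _ _ _ (fun q : R * 'rV[R]_n =>
    (q.2, eta (Num.max 0 q.1) w)) f); last exact: f_cont.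
  have noise_cont :
      {for p, continuous (fun q : R * 'rV[R]_n => eta (Num.max 0 q.1) w)}.
    apply: (@continuous_comp _ _ _ fst (fun t : R => eta (Num.max 0 t) w)).
      exact: cvg_fst.
    exact: eta_cont.
  exact: cvg_pair cvg_snd noise_cont.
- by move=> t y t0; rewrite /rode /G /= max_r.
- move=> t y _ Fy.
  exact: (flow_invariant_tangent F _ y F_C2.1 (f_wp _) (f_inv _) Fy).
Qed.
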